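(* Let $q>1$, $0<u<1$ and let $n\ge0$ be an integer. Run the following procedure. Start with $N=1$, $\lambda$ the empty partition, and a counter $r=n$. Step 1: if $r=0$ go to Step 3; otherwise set $h=1-q^{-r}$. Step 2: flip a (fresh, independent) coin with heads probability $h$. If tails, set $N\leftarrow N+1$ and repeat Step 2. If heads, set $r\leftarrow r-1$, choose a column $S$ with $\Pr(S=1)=\frac{q^{N-\lambda'_1}-1}{q^N-1}$ and $\Pr(S=s)=\frac{q^{N-\lambda'_s}-q^{N-\lambda'_{s-1}}}{q^N-1}$ for $s>1$, add a box to column $S$ of $\lambda$, and go to Step 1. Step 3: choose $S$ with $\Pr(S=1)=q^{-\lambda'_1}$ and $\Pr(S=s)=q^{-\lambda'_s}-q^{-\lambda'_{s-1}}$ for $s>1$, add a box to column $S$, and output $\lambda$. Then the output is distributed according to $N_{u,q}$ conditioned on $|\lambda|=n+1$.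
   Context: $\lambda'_s$ is the length of column $s$ of the diagram of $\lambda$; adding a box to column $s$ increases $\lambda'_s$ by one. $N_{u,q}(\lambda)=\prod_{r\ge1}(1-u/q^r)\frac{u^{|\lambda|-1}(q^{\lambda'_1}-1)}{\prod_i q^{(\lambda'_i)^2}(\frac1q)_{m_i(\lambda)}}$ for partitions $\lambda$ of positive integers, where $m_i(\lambda)$ is the multiplicity of part $i$ and $(\frac1q)_i=\prod_{j=1}^i(1-q^{-j})$. *)

(* Defs.v *)
From HB Require Import structures.
From mathcomp Require Import all_boot all_order all_algebra.
From mathcomp Require Import all_classical all_reals all_analysis.
Set Implicit Arguments. Unset Strict Implicit. Unset Printing Implicit Defensive.
Import Order.TTheory GRing.Theory Num.Theory.
Local Open Scope ring_scope.

Definition is_partition_of (m : nat) (l : seq nat) : bool :=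
  [&& sorted geq l, all (fun p => 0 < p)%N l & sumn l == m].

Definition colLen (l : seq nat) (s : nat) : nat := count (fun p => (s <= p)%N) l.

Definition mult (l : seq nat) (i : nat) : nat := count_mem i l.

(* add a box to column s: the row of index lambda'_s + 1 (0-based: lambda'_s) grows by one
   (this is exactly "add a box in column s" whenever the result is a partition, i.e.
   whenever s = 1 or lambda'_s < lambda'_(s-1); other choices have probability 0). *)
Definition addBox (l : seq nat) (s : nat) : seq nat := incr_nth l (colLen l s).

Definition ncols (l : seq nat) : nat := head 0%N l.

Section Defs.
Variable R : realType.

Definition qpoch (q : R) (i : nat) : R := \prod_(1 <= j < i.+1) (1 - q ^- j).

Definition infprod (u q : R) : R := limn (fun K => \prod_(1 <= r < K.+1) (1 - u / q ^+ r)).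

Definition Nuq (u q : R) (l : seq nat) : R :=
  infprod u q * (u ^+ (sumn l).-1 * (q ^+ colLen l 1 - 1)) /
  \prod_(1 <= i < (ncols l).+1) (q ^+ (colLen l i ^ 2) * qpoch q (mult l i)).

Fixpoint seqs_upto (len b : nat) : seq (seq nat) :=
  match len with
  | 0 => [:: [::]]
  | l.+1 => [::] :: [seq x :: s | x <- iota 0 b.+1, s <- seqs_upto l b]
  end.

Definition partitions (m : nat) : seq (seq nat) :=
  [seq l <- seqs_upto m m | is_partition_of m l].

Definition Nuq_cond (u q : R) (m : nat) (l : seq nat) : R :=
  if is_partition_of m l then
    Nuq u q l / \sum_(nu <- partitions m) Nuq u q nu
  else 0.

Definition p2 (q : R) (N : nat) (l : seq nat) (s : nat) : R :=
  if s == 1%N then (q ^+ N / q ^+ colLen l 1 - 1) / (q ^+ N - 1)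
  else (q ^+ N / q ^+ colLen l s - q ^+ N / q ^+ colLen l s.-1) / (q ^+ N - 1).

Definition p3 (q : R) (l : seq nat) (s : nat) : R :=
  if s == 1%N then q ^- colLen l 1
  else q ^- colLen l s - q ^- colLen l s.-1.

(* run q r N l mu = probability that the procedure, started at Step 1 with counter r,
   current value N and current partition l, outputs mu.  At Step 2 with counter r+1,
   k tails (prob. (1-h)^k h, h = 1 - q^{-(r+1)}) bring N to N+k, then a column is chosen.
   Columns s > ncols l + 1 have probability 0 and are omitted. *)
Fixpoint run (q : R) (r N : nat) (l mu : seq nat) : R :=
  match r with
  | 0 => \sum_(1 <= s < (ncols l).+2) p3 q l s * (addBox l s == mu)%:R
  | r'.+1 =>
      let h := 1 - q ^- r'.+1 in
      limn (fun K => \sum_(k < K)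
        ((1 - h) ^+ k * h *
         \sum_(1 <= s < (ncols l).+2) p2 q (N + k) l s * run q r' (N + k) (addBox l s) mu))
  end.

Definition output_prob (q : R) (n : nat) (mu : seq nat) : R := run q n 1 [::] mu.

End Defs.

(* Main.v *)
Require Import Defs.
From HB Require Import structures.
From mathcomp Require Import all_boot all_order all_algebra.
From mathcomp Require Import all_classical all_reals all_analysis.
From mathcomp Require Import zify ring lra.
Import Order.TTheory GRing.Theory Num.Theory.
Import numFieldNormedType.Exports.
Local Open Scope ring_scope.

(** Write [w_N(l) = (1/q)_N / (1/q)_(N - l'_1) / den l], where [den l] is the
    denominator of [N_{u,q}(l)], and [w_N(l) = 0] if [l'_1 > N].  These weights
    satisfy
      [w_N(mu) - w_(N-1)(mu) = q^-N * sum_(l + box s = mu) w_N(l) p2(N, l, s)],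
    because each removable corner [s] of [mu] contributes a multiple of
    [q^(mu'_s) - q^(mu'_(s+1))], and these differences telescope.  If [V r N l] is
    the expected value of a function [g] of the partition present when Step 3 is
    reached, the coin flip gives
      [V (r+1) N l = (1 - q^-(r+1)) sum_s p2(N, l, s) V r N (l + s)
                     + q^-(r+1) V (r+1) (N+1) l].
    Averaging over [l |- j] with weights [w_N], multiplying by [q^-((r+1)N)] and
    summing over [N], the left side and the last term telescope, so [V n 1 [::]]
    reduces to [q^n (1/q)_n sum_(l |- n) g(l) / den l].  The same corner
    computation with [p3] instead of [p2] shows that Step 3 turns the weights
    [1 / den] into [(q^(mu'_1) - 1) / den mu].  Taking [g = 1] yields the
    normalising constant. *)

Definition is_part (l : seq nat) : bool :=
  sorted geq l && all (fun p => 0 < p)%N l.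

Lemma is_partition_ofE m l : is_partition_of m l = is_part l && (sumn l == m).
Proof. by rewrite /is_partition_of /is_part andbA. Qed.

Lemma geq_trans : transitive geq.
Proof. by move=> y x z /= yx zy; apply: leq_trans zy yx. Qed.

(** * Partitions and their columns *)

Lemma seqs_uptoS len b : seqs_upto len.+1 b =
  [::] :: [seq x :: s | x <- iota 0 b.+1, s <- seqs_upto len b].
Proof. by []. Qed.

Lemma mem_seqs_upto len b l : (size l <= len)%N -> all (fun x => x <= b)%N l ->
  l \in seqs_upto len b.
Proof.
elim: len l => [|n IH] [|x l] // sl /andP[xb lb].
rewrite seqs_uptoS in_cons; apply/orP; right.
apply/allpairsP; exists (x, l); split; rewrite ?mem_iota //=; last exact: IH.
Qed.

Lemma seqs_upto_uniq len b : uniq (seqs_upto len b).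
Proof.
elim: len => [//|n IH]; rewrite seqs_uptoS cons_uniq; apply/andP; split.
  by apply/negP => /allpairsP[] [x l] [].
apply: allpairs_uniq => //; first exact: iota_uniq.
by move=> [x l] [y k] _ _ [-> ->].
Qed.

Lemma partitions_uniq m : uniq (partitions m).
Proof. exact/filter_uniq/seqs_upto_uniq. Qed.

Lemma size_le_sumn l : all (fun p => 0 < p)%N l -> (size l <= sumn l)%N.
Proof. by elim: l => //= x l IH /andP[x0 /IH]; lia. Qed.

Lemma all_le_sumn l : all (fun x => x <= sumn l)%N l.
Proof.
elim: l => //= x l IH; rewrite leq_addr /=.
by apply: sub_all IH => y; lia.
Qed.

(** Bounding both length and entries by [m] loses nothing: positive parts with sum [m] number at
    most [m], and each is at most [m]. *)
Lemma mem_partitions m l : (l \in partitions m) = is_partition_of m l.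
Proof.
rewrite mem_filter; case Pl: is_partition_of => //=.
move: Pl; rewrite is_partition_ofE => /andP[/andP[_ pos] /eqP <-].
by apply: mem_seqs_upto; [apply: size_le_sumn | apply: all_le_sumn].
Qed.

Lemma partitions0 : partitions 0 = [:: [::]].
Proof. by []. Qed.

Lemma colLen_le l s t : (s <= t)%N -> (colLen l t <= colLen l s)%N.
Proof. by move=> st; apply: sub_count => x /=; lia. Qed.

Lemma colLen_le_size l s : (colLen l s <= size l)%N.
Proof. exact: count_size. Qed.

Lemma mult_colLen l s : mult l s = (colLen l s - colLen l s.+1)%N.
Proof.
suff: (mult l s + colLen l s.+1 = colLen l s)%N by lia.
by rewrite /mult /colLen; elim: l => //= x l /=; case: (ltngtP s x) => /=; lia.
Qed.

(** Conjugation of diagrams: both sides say that the cell in row [i] and column [s] is present. The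
    condition [0 < s] excludes rows past the end, where [nth] returns the default [0]. *)
Lemma nth_geq_colLen l s i : sorted geq l -> (0 < s)%N ->
  (s <= nth 0 l i)%N = (i < colLen l s)%N.
Proof.
move=> + s0; elim: l i => [|x l IH] i /= Sl; first by rewrite nth_nil /colLen /=; lia.
have Sl' := path_sorted Sl.
have H : (x < s)%N -> colLen l s = 0%N.
  move=> xs; apply/eqP; rewrite -leqn0 leqNgt -has_count; apply/hasP => -[y yl /=].
  by have /allP/(_ y yl) /= := order_path_min geq_trans Sl; lia.
rewrite /colLen /= -/(colLen l s); case: i => [|i] /=.
  by case: (leqP s x) => [|/H ->].
rewrite IH //; case: (leqP s x) => [|/H ->] /=; lia.
Qed.

Lemma colLen_gt_ncols l s : sorted geq l -> (ncols l < s)%N -> colLen l s = 0%N.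
Proof.
move=> Sl ls; have s0 : (0 < s)%N by lia.
have := nth_geq_colLen _ _ 0 Sl s0; rewrite nth0 -/(ncols l); lia.
Qed.

Lemma ncols_le_sumn l : (ncols l <= sumn l)%N.
Proof. by case: l => //= x l; exact: leq_addr. Qed.

(** Multiplicities are differences of consecutive column lengths, and a sorted list is determined by
    its multiplicities. Equalities of partitions can thus be checked column by column. *)
Lemma part_colLen_inj l1 l2 : is_part l1 -> is_part l2 ->
  (forall s, (0 < s)%N -> colLen l1 s = colLen l2 s) -> l1 = l2.
Proof.
move=> /andP[S1 P1] /andP[S2 P2] e.
have no0 l : all (fun p => 0 < p)%N l -> count_mem 0%N l = 0%N.
  by move=> H; apply/count_memPn/negP => /(allP H).
apply: (sorted_eq geq_trans _ S1 S2); first by move=> x y /=; lia.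
apply/allP => x _ /=; apply/eqP; case: x => [|x]; first by rewrite !no0.
by rewrite -!/(mult _ _) !mult_colLen !e.
Qed.

(** * Adding and removing boxes *)

(** Column 1 needs its own clause: [colLen l 0] counts all rows, so for positive parts it equals
    [colLen l 1] and the strict inequality fails. *)
Definition addable (l : seq nat) (s : nat) : bool :=
  (s == 1)%N || (colLen l s < colLen l s.-1)%N.

Definition removable (l : seq nat) (s : nat) : bool :=
  (colLen l s.+1 < colLen l s)%N.

(* For [s = 1] the decremented row becomes [0] and is dropped by the filter. *)
Definition remBox (l : seq nat) (s : nat) : seq nat :=
  [seq x <- set_nth 0%N l (colLen l s).-1 s.-1 | (0 < x)%N].

Lemma incr_nthE l k : incr_nth l k = set_nth 0%N l k (nth 0%N l k).+1.
Proof.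
elim: l k => [|x l IH] [|k] //=; by rewrite IH.
Qed.

Lemma nth_addable l s : sorted geq l -> (0 < s)%N -> addable l s ->
  nth 0%N l (colLen l s) = s.-1.
Proof.
move=> Sl s0 al.
have H1 := nth_geq_colLen _ _ (colLen l s) Sl s0.
case: (ltnP 1 s) => [s1|]; last lia.
have s10 : (0 < s.-1)%N by lia.
have H2 := nth_geq_colLen _ _ (colLen l s) Sl s10.
move: al; rewrite /addable; lia.
Qed.

Lemma colLen_addBox l s t : sorted geq l -> (0 < s)%N -> (0 < t)%N -> addable l s ->
  colLen (addBox l s) t = (colLen l t + (t == s))%N.
Proof.
move=> Sl s0 t0 al.
have H := nth_addable _ _ Sl s0 al.
rewrite /addBox incr_nthE H {1}/colLen count_set_nthF; last lia.
rewrite -/(colLen l t) H.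
have : (t == s)%N -> colLen l t = colLen l s by move=> /eqP ->.
have := colLen_le l t s; have := colLen_le l s t; lia.
Qed.

Lemma sumn_addBox l s : sumn (addBox l s) = (sumn l).+1.
Proof. by rewrite /addBox incr_nthE sumn_set_nth0; lia. Qed.

Lemma is_part_addBox l s : is_part l -> (0 < s)%N -> addable l s ->
  is_part (addBox l s).
Proof.
move=> /andP[Sl Pl] s0 al; have H := nth_addable _ _ Sl s0 al.
have kl := colLen_le_size l s.
have nthle i : (nth 0 l i.+1 <= nth 0 l i)%N.
  case: (ltnP i.+1 (size l)) => [il|?]; last by rewrite nth_default.
  by have /(sortedP 0%N)/(_ _ il) := Sl.
have Hk i : (s <= nth 0 l i)%N = (i < colLen l s)%N by apply: nth_geq_colLen.
rewrite /is_part /addBox; apply/andP; split.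
  apply/(sortedP 0%N) => i _ /=; rewrite !nth_incr_nth.
  have := nthle i; have := Hk i.
  have : colLen l s = i.+1 -> nth 0%N l i.+1 = s.-1 by move=> <-.
  by do 2 case: eqP => ? /=; lia.
apply/(all_nthP 0%N) => i; rewrite size_incr_nth nth_incr_nth.
have /(all_nthP 0%N)/(_ i) := Pl.
by case: (ltnP (colLen l s) (size l)) => ?; case: eqP => /=; lia.
Qed.

Lemma is_partition_addBox m l s : is_partition_of m l -> (0 < s)%N -> addable l s ->
  is_partition_of m.+1 (addBox l s).
Proof.
rewrite !is_partition_ofE sumn_addBox => /andP[Pl /eqP ->] s0 al.
by rewrite is_part_addBox //=.
Qed.

Lemma removable_addBox l s : sorted geq l -> (0 < s)%N -> addable l s ->
  removable (addBox l s) s.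
Proof.
move=> Sl s0 al; rewrite /removable !colLen_addBox //.
have := colLen_le l s s.+1; rewrite eqxx; lia.
Qed.

Lemma nth_removable l s : sorted geq l -> (0 < s)%N -> removable l s ->
  nth 0%N l (colLen l s).-1 = s.
Proof.
rewrite /removable => Sl s0 rl.
have s1 : (0 < s.+1)%N by lia.
have H1 := nth_geq_colLen _ _ (colLen l s).-1 Sl s0.
have H2 := nth_geq_colLen _ _ (colLen l s).-1 Sl s1.
lia.
Qed.

Lemma colLen_remBox l s t : sorted geq l -> (0 < s)%N -> (0 < t)%N -> removable l s ->
  colLen (remBox l s) t = (colLen l t - (t == s))%N.
Proof.
move=> Sl s0 t0 rl; have H := nth_removable _ _ Sl s0 rl.
rewrite /remBox {1}/colLen count_filter.
rewrite (@eq_count _ _ (fun p => t <= p)%N); last by move=> x /=; lia.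
rewrite count_set_nthF; last lia.
rewrite -/(colLen l t) H.
have : (t == s)%N -> colLen l t = colLen l s by move=> /eqP ->.
move: rl; rewrite /removable.
have := colLen_le l t s; have := colLen_le l s t; lia.
Qed.

Lemma is_part_remBox l s : is_part l -> (0 < s)%N -> removable l s ->
  is_part (remBox l s).
Proof.
move=> /andP[Sl Pl] s0 rl; have H := nth_removable _ _ Sl s0 rl.
rewrite /is_part /remBox filter_all andbT.
apply: (sorted_filter geq_trans).
have nthle i : (nth 0 l i.+1 <= nth 0 l i)%N.
  case: (ltnP i.+1 (size l)) => [il|?]; last by rewrite nth_default.
  by have /(sortedP 0%N)/(_ _ il) := Sl.
have Hk i : (s.+1 <= nth 0 l i)%N = (i < colLen l s.+1)%N by apply: nth_geq_colLen.
have Hk' i : (s <= nth 0 l i)%N = (i < colLen l s)%N by apply: nth_geq_colLen.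
move: rl; rewrite /removable => rl.
apply/(sortedP 0%N) => i _ /=; rewrite !nth_set_nth /=.
have := nthle i; have := Hk i; have := Hk' i; have := Hk' i.+1;
  do 2 (case: eqP => ? /=); lia.
Qed.

Lemma addable_remBox l s : sorted geq l -> (0 < s)%N -> removable l s ->
  addable (remBox l s) s.
Proof.
move=> Sl s0 rl; rewrite /addable; case: (ltnP 1 s) => s1; last by apply/orP; left; lia.
apply/orP; right; rewrite !colLen_remBox //; last lia.
move: rl; rewrite /removable.
have := colLen_le l s.-1 s; rewrite eqxx; lia.
Qed.

Lemma remBoxK l s : is_part l -> (0 < s)%N -> removable l s ->
  addBox (remBox l s) s = l.
Proof.
move=> Pl s0 rl; have /andP[Sl _] := Pl.
have al := addable_remBox _ _ Sl s0 rl.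
have Pr := is_part_remBox _ _ Pl s0 rl; have /andP[Sr _] := Pr.
apply: part_colLen_inj => //; first exact: is_part_addBox.
move=> t t0; rewrite colLen_addBox // colLen_remBox //.
by have := rl; rewrite /removable; case: eqP => [->|]; lia.
Qed.

Lemma addBox_inj l1 l2 s : is_part l1 -> is_part l2 -> (0 < s)%N ->
  addable l1 s -> addable l2 s -> addBox l1 s = addBox l2 s -> l1 = l2.
Proof.
move=> P1 P2 s0 a1 a2 e; have /andP[S1 _] := P1; have /andP[S2 _] := P2.
apply: part_colLen_inj => // t t0.
by have := congr1 (colLen^~ t) e; rewrite !colLen_addBox //; lia.
Qed.

Lemma is_partition_remBox m l s : is_partition_of m.+1 l -> (0 < s)%N ->
  removable l s -> is_partition_of m (remBox l s).
Proof.
rewrite !is_partition_ofE => /andP[Pl /eqP sl] s0 rl.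
rewrite is_part_remBox //=.
by have := sumn_addBox (remBox l s) s; rewrite remBoxK // sl => -[<-].
Qed.

Lemma mem_filter_partitions (P : pred (seq nat)) m l :
  (l \in [seq k <- partitions m | P k]) = P l && is_partition_of m l.
Proof. by rewrite mem_filter mem_partitions. Qed.

Lemma perm_addBox m s : (0 < s)%N ->
  perm_eq [seq addBox l s | l <- partitions m & addable l s]
          [seq l <- partitions m.+1 | removable l s].
Proof.
move=> s0; apply: uniq_perm.
- rewrite map_inj_in_uniq; first exact/filter_uniq/partitions_uniq.
  move=> l1 l2; rewrite !mem_filter_partitions !is_partition_ofE.
  by move=> /and3P[? ? _] /and3P[? ? _]; apply: addBox_inj.
- exact/filter_uniq/partitions_uniq.
- move=> l; apply/mapP/idP.
    move=> [k]; rewrite !mem_filter_partitions => /andP[ak Pk] ->.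
    rewrite is_partition_addBox // andbT.
    by move: Pk => /and3P[Sk _ _]; apply: removable_addBox.
  rewrite !mem_filter_partitions => /andP[rl Pl]; exists (remBox l s).
    rewrite mem_filter_partitions is_partition_remBox // andbT.
    by move: Pl => /and3P[Sl _ _]; apply: addable_remBox.
  rewrite remBoxK //; by move: Pl; rewrite is_partition_ofE => /andP[].
Qed.

Lemma not_removable_colLen l s : ~~ removable l s -> colLen l s = colLen l s.+1.
Proof. by rewrite /removable; have := colLen_le l s s.+1; lia. Qed.

Lemma not_addable_colLen l s : (0 < s)%N -> ~~ addable l s ->
  (s != 1)%N /\ colLen l s = colLen l s.-1.
Proof. by rewrite /addable; have := colLen_le l s.-1 s; lia. Qed.

(** Change of variable from a partition with a corner to add to a partition with a corner to remove.
    The vanishing conditions allow one common range of columns, so that the sums can be exchanged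
    and [perm_addBox] applied for each [s]. *)
Lemma sum_addBox (V : zmodType) m (F H : seq nat -> nat -> V) :
  (forall l s, is_partition_of m l -> (0 < s)%N -> ~~ addable l s -> F l s = 0) ->
  (forall l s, is_partition_of m l -> (0 < s)%N -> addable l s ->
     F l s = H (addBox l s) s) ->
  (forall l s, is_partition_of m.+1 l -> (0 < s)%N -> ~~ removable l s -> H l s = 0) ->
  \sum_(l <- partitions m) \sum_(1 <= s < (ncols l).+2) F l s =
  \sum_(l <- partitions m.+1) \sum_(1 <= s < m.+2) H l s.
Proof.
move=> F0 FH H0.
transitivity (\sum_(l <- partitions m) \sum_(1 <= s < m.+2) F l s).
  apply: eq_big_seq => l; rewrite mem_partitions => Pl.
  have [Sl lm] : sorted geq l /\ (ncols l <= m)%N.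
    by have := ncols_le_sumn l; move: Pl => /and3P[-> _ /eqP ->].
  rewrite [RHS](@big_cat_nat _ _ _ (ncols l).+2) //= [X in _ = _ + X]big1_seq ?addr0 //.
  (* In the extra columns both [s] and [s.-1] are empty, so no box can be added there. *)
  move=> s /andP[_]; rewrite mem_index_iota => ls; apply: F0 => //; first lia.
  rewrite /addable; have -> : colLen l s.-1 = 0%N by apply: colLen_gt_ncols => //; lia.
  lia.
rewrite exchange_big [RHS]exchange_big /=; apply: eq_big_seq => s.
rewrite mem_index_iota => /andP[s0 _].
have -> : \sum_(l <- partitions m) F l s =
    \sum_(k <- [seq addBox l s | l <- partitions m & addable l s]) H k s.
  rewrite big_map big_filter [RHS]big_mkcond; apply: eq_big_seq => l.
  rewrite mem_partitions => Pl.
  by case: ifPn => al; [apply: FH | apply: F0].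
rewrite (perm_big _ (perm_addBox m s s0)) big_filter big_mkcond; apply: eq_big_seq => l.
rewrite mem_partitions => Pl.
by case: ifPn => // rl; rewrite H0.
Qed.

(** * Weights *)

Lemma prod_update (R : comPzRingType) (I : eqType) (r : seq I) (i : I) (F G : I -> R) :
  uniq r -> i \in r -> {in r, forall j, j != i -> F j = G j} ->
  F i * \prod_(j <- r) G j = G i * \prod_(j <- r) F j.
Proof.
move=> ur ir FG; rewrite !(bigD1_seq i) //= mulrCA; congr (_ * (_ * _)).
rewrite big_seq_cond [RHS]big_seq_cond.
by apply: eq_bigr => j /andP[jr ji]; rewrite FG.
Qed.

Section Weights.
Local Open Scope classical_set_scope.
Variables (R : realType) (q : R).
Hypothesis q1 : 1 < q.

Lemma q_gt0 : 0 < q. Proof. exact: lt_trans q1. Qed.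

Lemma expq_gt0 i : 0 < q ^+ i. Proof. by rewrite exprn_gt0 // q_gt0. Qed.

Lemma expq_neq0 i : q ^+ i != 0. Proof. by rewrite gt_eqF // expq_gt0. Qed.

Lemma expq_gt1 i : (0 < i)%N -> 1 < q ^+ i.
Proof. by move=> i0; rewrite exprn_egt1 // -lt0n. Qed.

Lemma qpochS i : qpoch q i.+1 = qpoch q i * (1 - q ^- i.+1).
Proof. by rewrite /qpoch big_nat_recr. Qed.

Lemma subr_expVq_gt0 i : (0 < i)%N -> 0 < 1 - q ^- i.
Proof. by move=> i0; rewrite subr_gt0 invf_lt1 ?expq_gt0 // expq_gt1. Qed.

Lemma qpoch_gt0 i : 0 < qpoch q i.
Proof.
elim: i => [|i IH]; first by rewrite /qpoch big_geq.
by rewrite qpochS mulr_gt0 // subr_expVq_gt0.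
Qed.

Lemma qpoch_neq0 i : qpoch q i != 0. Proof. by rewrite gt_eqF // qpoch_gt0. Qed.

Definition den (l : seq nat) : R :=
  \prod_(1 <= i < (ncols l).+1) (q ^+ (colLen l i ^ 2) * qpoch q (mult l i)).

Lemma den_gt0 l : 0 < den l.
Proof. by apply: prodr_gt0 => i _; rewrite mulr_gt0 ?expq_gt0 ?qpoch_gt0. Qed.

Lemma den_neq0 l : den l != 0. Proof. by rewrite gt_eqF // den_gt0. Qed.

(** Factors past the last column are 1; a common bound [B] lets the products for [l] and
    [addBox l s] be compared factor by factor. *)
Lemma den_widen l B : sorted geq l -> (ncols l <= B)%N ->
  den l = \prod_(1 <= i < B.+1)
    (q ^+ (colLen l i ^ 2) * qpoch q (colLen l i - colLen l i.+1)).
Proof.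
move=> Sl lB; rewrite (@big_cat_nat _ _ _ (ncols l).+1) //=.
rewrite [X in _ = _ * X]big1_seq ?mulr1; last first.
  move=> i /andP[_]; rewrite mem_index_iota => /andP[li _].
  rewrite !colLen_gt_ncols //; last lia.
  by rewrite mul1r /qpoch big_geq.
by apply: eq_bigr => i _; rewrite mult_colLen.
Qed.

(** Only two factors change. In factor [s] the square grows by twice the column length plus one and
    the multiplicity of [s] rises by one; in factor [s.-1], absent when [s = 1], the multiplicity
    drops by one. *)
Lemma den_addBox l s : is_part l -> (0 < s)%N -> addable l s ->
  den (addBox l s) * (if s == 1%N then 1 else 1 - q ^- (colLen l s.-1 - colLen l s)) =
  den l * q ^+ (colLen l s).*2.+1 * (1 - q ^- ((colLen l s).+1 - colLen l s.+1)).
Proof.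
move=> Pl s0 al; have /andP[Sl _] := Pl.
have /andP[Sl' _] := is_part_addBox _ _ Pl s0 al.
have colB i : (0 < i)%N -> i <> s -> colLen (addBox l s) i = colLen l i.
  by move=> i0 /eqP /negbTE nis; rewrite colLen_addBox // nis addn0.
have colBs : colLen (addBox l s) s = (colLen l s).+1.
  by rewrite colLen_addBox // eqxx addn1.
pose B := (ncols l + ncols (addBox l s) + s)%N.
have [lB l'B] : (ncols l <= B)%N /\ (ncols (addBox l s) <= B)%N by rewrite /B; lia.
rewrite (den_widen _ B Sl lB) (den_widen _ B Sl' l'B).
set F' := fun i => q ^+ (colLen (addBox l s) i ^ 2) *
  qpoch q (colLen (addBox l s) i - colLen (addBox l s) i.+1).
set F := fun i => q ^+ (colLen l i ^ 2) * qpoch q (colLen l i - colLen l i.+1).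
(* A hybrid of the old factors below [s] and the new ones from [s] on: it differs from [F] only at
   [s] and from [F'] only at [s.-1]. *)
pose G i := if (i < s)%N then F i else F' i.
have F_neq0 i : F i != 0 by rewrite mulf_neq0 ?expq_neq0 ?qpoch_neq0.
have F'_neq0 i : F' i != 0 by rewrite mulf_neq0 ?expq_neq0 ?qpoch_neq0.
have ur : uniq (index_iota 1 B.+1) by apply: iota_uniq.
have sr : s \in index_iota 1 B.+1 by rewrite mem_index_iota /B; lia.
have F's : F' s = F s * (q ^+ (colLen l s).*2.+1 *
    (1 - q ^- ((colLen l s).+1 - colLen l s.+1))).
  rewrite /F' /F colBs colB //; last lia.
  rewrite subSn ?colLen_le // qpochS.
  have -> : ((colLen l s).+1 ^ 2 = colLen l s ^ 2 + (colLen l s).*2.+1)%N.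
    by rewrite -addn1 sqrnD muln1 exp1n mul2n -addnA add1n.
  by rewrite exprD; ring.
have eqG : \prod_(i <- index_iota 1 B.+1) G i = q ^+ (colLen l s).*2.+1 *
    (1 - q ^- ((colLen l s).+1 - colLen l s.+1)) * \prod_(i <- index_iota 1 B.+1) F i.
  apply: (mulfI (F_neq0 s)); rewrite (@prod_update _ _ _ s F G) //.
    by rewrite {1}/G ltnn F's; ring.
  move=> i; rewrite mem_index_iota => ir /eqP neq_is; rewrite /G; case: ltnP => // le_si.
  by rewrite /F /F' !colB //; lia.
have eqF' : \prod_(i <- index_iota 1 B.+1) F' i *
    (if s == 1%N then 1 else 1 - q ^- (colLen l s.-1 - colLen l s)) =
    \prod_(i <- index_iota 1 B.+1) G i.
  have F'G i : (0 < i)%N -> i != s.-1 -> F' i = G i.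
    move=> i0 /eqP ne_is; rewrite /G; case: ltnP => // lt_is.
    by rewrite /F /F' !colB //; lia.
  case: eqP => s1.
    rewrite mulr1; apply: eq_big_seq => i; rewrite mem_index_iota => ir.
    by apply: F'G; lia.
  apply: (mulfI (F'_neq0 s.-1)); rewrite (@prod_update _ _ _ s.-1 F' G) //.
  - rewrite /G ltn_predL s0 mulrCA mulrA -[LHS]mulrA mulrC; congr (_ * _).
    rewrite /F' /F prednK // colBs colB; [|lia|lia].
    have -> : (colLen l s.-1 - colLen l s = (colLen l s.-1 - (colLen l s).+1).+1)%N.
      by move: al; rewrite /addable; lia.
    by rewrite qpochS; ring.
  - by rewrite mem_index_iota /B; lia.
  - by move=> i; rewrite mem_index_iota => ir ne; apply: F'G => //; lia.
by rewrite eqF' eqG; ring.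
Qed.

(** In [den_addBox], the factor for the multiplicity of [s.-1] is [p3] up to [q ^- colLen l s],
    while the factor for the multiplicity of [s] becomes the corner difference on the right. *)
Lemma p3_addBox l s : is_part l -> (0 < s)%N -> addable l s ->
  (den l)^-1 * p3 q l s = (den (addBox l s))^-1 *
    (q ^+ colLen (addBox l s) s - q ^+ colLen (addBox l s) s.+1).
Proof.
move=> Pl s0 al; have /andP[Sl _] := Pl.
have := den_addBox _ _ Pl s0 al.
rewrite !colLen_addBox // eqxx (_ : (s.+1 == s) = false) ?addn0 ?addn1; last lia.
have le_s := colLen_le l s s.+1 (leqnSn s).
have -> : q ^+ (colLen l s).+1 - q ^+ colLen l s.+1 =
    q ^+ (colLen l s).+1 * (1 - q ^- ((colLen l s).+1 - colLen l s.+1)).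
  rewrite mulrBr mulr1; congr (_ - _).
  by rewrite -expfB_cond ?(gt_eqF q_gt0) //=; [congr (_ ^+ _)|]; lia.
have -> : p3 q l s = q ^- colLen l s *
    (if s == 1%N then 1 else 1 - q ^- (colLen l s.-1 - colLen l s)).
  rewrite /p3; case: eqP => [->|s1]; first by rewrite mulr1.
  move: al; rewrite /addable => al.
  rewrite mulrBr mulr1 -invfM -exprD; congr (_ - _ ^- _); lia.
set x := if _ then _ else _; set y := (1 - _) => e.
have -> : x = den l * q ^+ (colLen l s).*2.+1 * y / den (addBox l s).
  by rewrite -e mulrAC mulfV ?den_neq0 // mul1r.
rewrite -addnn -addSn exprD.
by field; rewrite !den_neq0 expq_neq0.
Qed.

Definition wt (N : nat) (l : seq nat) : R :=
  if (colLen l 1 <= N)%N then qpoch q N / qpoch q (N - colLen l 1) / den l else 0.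

(** [p2] is [p3] with mass [q ^- N] removed from column 1, renormalised by [1 - q ^- N]. *)
Lemma p2E N l s : (0 < N)%N ->
  p2 q N l s = q ^+ N / (q ^+ N - 1) * (p3 q l s - (s == 1%N)%:R / q ^+ N).
Proof.
move=> N0; have qN1 : q ^+ N - 1 != 0 by rewrite subr_eq0 gt_eqF // expq_gt1.
rewrite /p2 /p3; case: eqP => _ /=; field; by rewrite !expq_neq0 qN1.
Qed.

(** For [s > 1] the first column is unchanged and [p3_addBox] suffices. For [s = 1] the mass removed
    from [p3] supplies the factor by which [qpoch q (N - colLen l 1)] changes. *)
Lemma wt_p2 N l s : (0 < N)%N -> is_part l -> (0 < s)%N -> addable l s ->
  wt N l * p2 q N l s = wt N (addBox l s) * (q ^+ N / (q ^+ N - 1)) *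
    (q ^+ colLen (addBox l s) s - q ^+ colLen (addBox l s) s.+1).
Proof.
move=> N0 Pl s0 al; have /andP[Sl _] := Pl.
have qN1 : q ^+ N - 1 != 0 by rewrite subr_eq0 gt_eqF // expq_gt1.
have e3 := p3_addBox _ _ Pl s0 al.
rewrite p2E //; case: (s =P 1%N) => [s1|s1]; last first.
  have e1 : colLen (addBox l s) 1 = colLen l 1.
    by rewrite colLen_addBox // (_ : (1%N == s) = false) ?addn0 //; lia.
  rewrite mul0r subr0 /wt e1; case: ifP => _; last by rewrite !mul0r.
  transitivity (qpoch q N / qpoch q (N - colLen l 1) * (q ^+ N / (q ^+ N - 1)) *
    ((den l)^-1 * p3 q l s)); first by ring.
  by rewrite e3; ring.
rewrite mul1r /wt; move: e3 al; rewrite s1 => e3 al.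
have eD : colLen (addBox l 1) 1 = (colLen l 1).+1 by rewrite colLen_addBox // eqxx addn1.
rewrite eD; case: (leqP (colLen l 1).+1 N) => lN.
  rewrite (ltnW lN).
  have -> : (N - colLen l 1 = (N - (colLen l 1).+1).+1)%N by lia.
  rewrite qpochS.
  transitivity (qpoch q N / qpoch q (N - (colLen l 1).+1) * (q ^+ N / (q ^+ N - 1)) *
    ((den l)^-1 * p3 q l 1)); last by rewrite e3 eD; ring.
  set k := (N - (colLen l 1).+1)%N.
  have -> : p3 q l 1 - (q ^+ N)^-1 = p3 q l 1 * (1 - q ^- k.+1).
    rewrite mulrBr mulr1 /p3 /= -invfM -exprD; congr (_ - _ ^- _).
    by rewrite /k; lia.
  have := subr_expVq_gt0 k.+1 isT; move: (1 - _) => z z0.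
  by field; rewrite qN1 den_neq0 qpoch_neq0 gt_eqF.
(* The new first column exceeds [N], so the right side is 0. On the left, [p2] vanishes if
   [colLen l 1 = N], and [wt] vanishes beyond that. *)
rewrite !mul0r; case: leqP => [lN'|_]; last by rewrite mul0r.
have -> : N = colLen l 1 by lia.
by rewrite /p3 /= subrr !mulr0.
Qed.

(** With [c = colLen l 1 <= N], the ratio [wt N l / wt N.+1 l] is
    [(1 - q ^- (N.+1 - c)) / (1 - q ^- N.+1)]. At [c = N.+1] the weight [wt N l] is 0 and the factor
    on the right is 1. *)
Lemma wt_diff N l : wt N.+1 l - wt N l =
  wt N.+1 l * ((q ^+ colLen l 1 - 1) / (q ^+ N.+1 - 1)).
Proof.
have qN1 : q ^+ N.+1 - 1 != 0 by rewrite subr_eq0 gt_eqF // expq_gt1.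
rewrite /wt; case: (leqP (colLen l 1) N) => [lN|lN].
  rewrite leqW // subSn //; set k := (N - colLen l 1)%N.
  have eN : (N.+1 = k.+1 + colLen l 1)%N by rewrite /k; lia.
  rewrite !qpochS eN exprD.
  have qk1 : q ^+ k.+1 - 1 != 0 by rewrite subr_eq0 gt_eqF // expq_gt1.
  move: qN1; rewrite eN exprD; move: (expq_neq0 k.+1) (expq_neq0 (colLen l 1)) qk1.
  move: (q ^+ k.+1) (q ^+ colLen l 1) => A C A0 C0 A1 AC1.
  by field; rewrite AC1 den_neq0 qpoch_neq0 A0 C0 A1.
rewrite subr0; case: leqP => lN'; last by rewrite mul0r.
by have -> : colLen l 1 = N.+1 by [lia]; rewrite mulfV // mulr1.
Qed.

Lemma p2_not_addable N l s : (0 < s)%N -> ~~ addable l s -> p2 q N l s = 0.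
Proof.
move=> s0 /(not_addable_colLen _ _ s0) [/negbTE s1 e].
by rewrite /p2 s1 e subrr mul0r.
Qed.

Lemma p3_not_addable l s : (0 < s)%N -> ~~ addable l s -> p3 q l s = 0.
Proof.
move=> s0 /(not_addable_colLen _ _ s0) [/negbTE s1 e].
by rewrite /p3 s1 e subrr.
Qed.

Lemma sum_expq_colLen m l : is_partition_of m l ->
  \sum_(1 <= s < m.+1) (q ^+ colLen l s - q ^+ colLen l s.+1) = q ^+ colLen l 1 - 1.
Proof.
move=> /and3P[Sl _ /eqP lm].
have -> : 1 = q ^+ colLen l m.+1.
  by rewrite colLen_gt_ncols // ltnS -lm ncols_le_sumn.
rewrite (@telescope_sumr_eq _ _ _ (fun s => - q ^+ colLen l s)) //.
  by rewrite opprK addrC.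
by move=> s _; rewrite opprK addrC.
Qed.

(** The corner differences telescope to [q ^+ colLen l 1 - 1], precisely the numerator in [wt_diff];
    a column choice thus becomes a difference in [N]. *)
Lemma sum_p2_addBox N m (f : seq nat -> R) :
  \sum_(l <- partitions m) wt N.+1 l *
    (\sum_(1 <= s < (ncols l).+2) p2 q N.+1 l s * f (addBox l s)) =
  q ^+ N.+1 * \sum_(l <- partitions m.+1) (wt N.+1 l - wt N l) * f l.
Proof.
have Pm k l : is_partition_of k l -> is_part l by rewrite is_partition_ofE => /andP[].
transitivity (\sum_(l <- partitions m) \sum_(1 <= s < (ncols l).+2)
    wt N.+1 l * p2 q N.+1 l s * f (addBox l s)).
  by apply: eq_bigr => l _; rewrite mulr_sumr; apply: eq_bigr => s _; rewrite mulrA.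
rewrite (sum_addBox _ _ _ (fun l s => wt N.+1 l * (q ^+ N.+1 / (q ^+ N.+1 - 1)) *
    (q ^+ colLen l s - q ^+ colLen l s.+1) * f l)).
- rewrite mulr_sumr; apply: eq_big_seq => l; rewrite mem_partitions => Pl.
  rewrite -mulr_suml -mulr_sumr sum_expq_colLen // wt_diff; ring.
- by move=> l s Pl s0 nal; rewrite p2_not_addable // mulr0 mul0r.
- by move=> l s Pl s0 al; rewrite wt_p2 // (Pm m).
- by move=> l s Pl s0 nrl; rewrite not_removable_colLen // subrr mulr0 mul0r.
Qed.

Lemma sum_p3_addBox m (f : seq nat -> R) :
  \sum_(l <- partitions m) (den l)^-1 *
    (\sum_(1 <= s < (ncols l).+2) p3 q l s * f (addBox l s)) =
  \sum_(l <- partitions m.+1) (q ^+ colLen l 1 - 1) / den l * f l.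
Proof.
have Pm k l : is_partition_of k l -> is_part l by rewrite is_partition_ofE => /andP[].
transitivity (\sum_(l <- partitions m) \sum_(1 <= s < (ncols l).+2)
    (den l)^-1 * p3 q l s * f (addBox l s)).
  by apply: eq_bigr => l _; rewrite mulr_sumr; apply: eq_bigr => s _; rewrite mulrA.
rewrite (sum_addBox _ _ _ (fun l s => (den l)^-1 *
    (q ^+ colLen l s - q ^+ colLen l s.+1) * f l)).
- apply: eq_big_seq => l; rewrite mem_partitions => Pl.
  by rewrite -mulr_suml -mulr_sumr sum_expq_colLen // [_^-1 * _]mulrC.
- by move=> l s Pl s0 nal; rewrite p3_not_addable // mulr0 mul0r.
- by move=> l s Pl s0 al; rewrite p3_addBox // (Pm m).
- by move=> l s Pl s0 nrl; rewrite not_removable_colLen // subrr mulr0 mul0r.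
Qed.

(** * Column choices as probability distributions *)

Lemma p3_ge0 l s : 0 <= p3 q l s.
Proof.
rewrite /p3; case: ifP => _; first by rewrite invr_ge0 ltW ?expq_gt0.
rewrite subr_ge0 lef_pV2 ?posrE ?expq_gt0 //.
by apply: ler_weXn2l; [exact: ltW | apply: colLen_le; exact: leq_pred].
Qed.

(** The sum telescopes to [q ^- 0], because the last column in the range is empty. *)
Lemma sum_p3 l : sorted geq l -> \sum_(1 <= s < (ncols l).+2) p3 q l s = 1.
Proof.
move=> Sl; rewrite big_nat_recl //=.
rewrite (@telescope_sumr_eq _ _ _ (fun s => q ^- colLen l s)) //; last first.
  by move=> [].
by rewrite /p3 /= (colLen_gt_ncols l (ncols l).+1) // expr0 invr1; ring.
Qed.

Lemma p2_ge0 N l s : (0 < N)%N -> (colLen l 1 <= N)%N -> 0 <= p2 q N l s.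
Proof.
move=> N0 lN; have qN1 := expq_gt1 _ N0.
rewrite p2E // mulr_ge0 //.
  by rewrite divr_ge0 // ltW // ?expq_gt0 // subr_gt0.
case: eqP => [->|_] /=; last by rewrite mul0r subr0 p3_ge0.
rewrite mul1r /p3 eqxx subr_ge0 lef_pV2 ?posrE ?expq_gt0 //.
by apply: ler_weXn2l; [exact: ltW|].
Qed.

Lemma sum_p2 N l : (0 < N)%N -> sorted geq l ->
  \sum_(1 <= s < (ncols l).+2) p2 q N l s = 1.
Proof.
move=> N0 Sl; have qN1 : q ^+ N - 1 != 0 by rewrite subr_eq0 gt_eqF // expq_gt1.
under eq_bigr do rewrite p2E //.
rewrite -mulr_sumr sumrB sum_p3 // big_nat_recl //= big1_seq; last first.
  move=> s /andP[_]; rewrite mem_index_iota eqSS => s1.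
  by rewrite (_ : (s == 0)%N = false) ?mul0r //; lia.
by field; rewrite expq_neq0 qN1.
Qed.

(** * Telescoping in N *)

Lemma eq_cvgn (f g : nat -> R) (a b : R) :
  f =1 g -> a = b -> g n @[n --> \oo] --> b -> f n @[n --> \oo] --> a.
Proof. by move=> /funext -> ->. Qed.

Lemma cvg_expVq : q ^- n @[n --> \oo] --> (0 : R).
Proof.
apply: (@eq_cvgn _ (fun n => q^-1 ^+ n) _ 0) => // [n|]; first by rewrite exprVn.
by apply: cvg_expr; rewrite ger0_norm ?invr_ge0 ?ltW ?q_gt0 // invf_lt1 ?q_gt0.
Qed.

Lemma cvg_qpoch_ratio a : qpoch q (n + a) / qpoch q n @[n --> \oo] --> (1 : R).
Proof.
elim: a => [|a IH].
  apply: (@eq_cvgn _ (fun=> 1) _ 1) => // [n|]; last exact: cvg_cst.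
  by rewrite addn0 mulfV ?qpoch_neq0.
apply: (@eq_cvgn _ (fun n => qpoch q (n + a) / qpoch q n * (1 - q ^- (n + a.+1)))
  _ (1 * (1 - 0))).
- by move=> n; rewrite !addnS qpochS mulrAC.
- by rewrite subr0 mulr1.
- apply: cvgM; first exact: IH.
  apply: cvgB; first exact: cvg_cst.
  by have := cvg_expVq; rewrite -(cvg_shiftn a.+1).
Qed.

Lemma cvg_wt l : wt N l @[N --> \oo] --> (den l)^-1.
Proof.
(* After this shift the weight is in its nonzero branch at every index. *)
rewrite -(cvg_shiftn (colLen l 1)) /=.
apply: (@eq_cvgn _ (fun n => qpoch q (n + colLen l 1) / qpoch q n * (den l)^-1)
  _ (1 * (den l)^-1)).
- by move=> n; rewrite /wt leq_addl addnK.
- by rewrite mul1r.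
- by apply: cvgM; [exact: cvg_qpoch_ratio | exact: cvg_cst].
Qed.

Lemma wt_ge0 N l : 0 <= wt N l.
Proof.
rewrite /wt; case: ifP => // _.
by rewrite !divr_ge0 // ltW // ?qpoch_gt0 ?den_gt0.
Qed.

Lemma wt_nil N : wt N [::] = 1.
Proof. by rewrite /wt /= subn0 mulfV ?qpoch_neq0 // /den big_geq // divr1. Qed.

Lemma wt0_partition m l : is_partition_of m.+1 l -> wt 0 l = 0.
Proof.
rewrite /wt => /and3P[_ Pl /eqP sl]; case: leqP => //.
by case: l Pl sl => [|x l] //= /andP[x0 _] _; rewrite /colLen /= x0.
Qed.

Lemma cvg_sum (I : eqType) (r : seq I) (F : I -> nat -> R) (G : I -> R) :
  (forall i, i \in r -> F i n @[n --> \oo] --> G i) ->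
  \sum_(i <- r) F i n @[n --> \oo] --> \sum_(i <- r) G i.
Proof.
elim: r => [|i r IH] FG.
  apply: (@eq_cvgn _ (fun=> 0) _ 0); [| |exact: cvg_cst].
    by move=> n; rewrite big_nil.
  by rewrite big_nil.
apply: (@eq_cvgn _ (fun n => F i n + \sum_(j <- r) F j n) _ (G i + \sum_(j <- r) G j)).
- by move=> n; rewrite big_cons.
- by rewrite big_cons.
apply: cvgD.
  by apply: FG; rewrite mem_head.
by apply: IH => j jr; apply: FG; rewrite in_cons jr orbT.
Qed.

Section Process.
(** Keeping [V] abstract allows two instances: [run], and the constant 1, which gives the
    normalising constant. *)
Variables (V : nat -> nat -> seq nat -> R) (g : seq nat -> R).
Hypothesis V0 : forall N l, V 0 N l = g l.
Hypothesis V_bound : forall r N l, is_part l -> (0 < N)%N -> (colLen l 1 <= N)%N ->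
  `|V r N l| <= 1.
Hypothesis V_rec : forall r N l, is_part l -> (0 < N)%N -> (colLen l 1 <= N)%N ->
  V r.+1 N l =
    (1 - q ^- r.+1) * (\sum_(1 <= s < (ncols l).+2) p2 q N l s * V r N (addBox l s)) +
    q ^- r.+1 * V r.+1 N.+1 l.

(* [M] indexes the weight and [N] the state: the recursion compares [M = N] with
   [M = N - 1]. *)
Let mean r j M N := \sum_(l <- partitions j) wt M l * V r N l.

(* The last summand is the boundary term of the telescoping sum; it vanishes unless
   [j = 0], while for [j = 0] the sum vanishes. *)
Let partial r j K := \sum_(0 <= N < K) (q ^- (r * N.+1) *
  (mean r j N.+1 N.+1 - mean r j N N.+1)) + q ^- r * mean r j 0 1.

Lemma mean_rec r j N : mean r.+1 j N.+1 N.+1 =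
  (1 - q ^- r.+1) * (q ^+ N.+1 * (mean r j.+1 N.+1 N.+1 - mean r j.+1 N N.+1)) +
  q ^- r.+1 * mean r.+1 j N.+1 N.+2.
Proof.
rewrite /mean -sumrB; under [in RHS]eq_bigr do rewrite -mulrBl.
rewrite -sum_p2_addBox !mulr_sumr -big_split /=; apply: eq_big_seq => l.
rewrite mem_partitions is_partition_ofE => /andP[Pl _].
case: (leqP (colLen l 1) N.+1) => lN; first by rewrite V_rec //; ring.
by rewrite /wt leqNgt lN /= !mul0r !mulr0 addr0.
Qed.

Lemma mean0 r j : mean r j.+1 0 1 = 0.
Proof.
rewrite /mean big1_seq // => l /andP[_]; rewrite mem_partitions => Pl.
by rewrite (wt0_partition j) // mul0r.
Qed.

(** The factor [q ^+ N.+1] of [mean_rec] lowers the exponent from [r.+1] to [r] times [N.+1], and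
    [q ^- r.+1] aligns its last term with the subtracted term of the next summand. These cancel,
    leaving only the term at [K]; the initial one cancels the boundary term of [partial]. *)
Lemma partial_rec r j K : partial r.+1 j K =
  (1 - q ^- r.+1) * partial r j.+1 K + q ^- (r.+1 * K.+1) * mean r.+1 j K K.+1.
Proof.
elim: K => [|K IH].
  by rewrite /partial !big_geq // mean0 mulr0 !add0r mulr0 add0r muln1.
have partialS r' j' : partial r' j' K.+1 = partial r' j' K +
    q ^- (r' * K.+1) * (mean r' j' K.+1 K.+1 - mean r' j' K K.+1).
  by rewrite /partial big_nat_recr //= addrAC.
rewrite !partialS IH mean_rec.
have -> : (r.+1 * K.+2 = r.+1 * K.+1 + r.+1)%N by rewrite mulnS addnC.
have -> : q ^- (r * K.+1) = q ^- (r.+1 * K.+1) * q ^+ K.+1.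
  rewrite [(r.+1 * _)%N]mulSn exprD; field.
  by rewrite !expq_neq0.
rewrite [q ^+ (_ + r.+1)]exprD invfM; ring.
Qed.

(** Since [V] is bounded by 1, the error is at most [q ^- K.+1] times the total weight, which
    converges. *)
Lemma cvg_mean_error r j :
  q ^- (r.+1 * K.+1) * mean r.+1 j K K.+1 @[K --> \oo] --> (0 : R).
Proof.
pose b K := q ^- K.+1 * \sum_(l <- partitions j) wt K l.
have b0 : b K @[K --> \oo] --> (0 : R).
  rewrite -[X in _ --> X](mul0r (\sum_(l <- partitions j) (den l)^-1)).
  apply: cvgM; first by have := cvg_expVq; rewrite -cvg_shiftS.
  by apply: cvg_sum => l _; exact: cvg_wt.
apply: (@squeeze_cvgr _ _ _ _ (fun K => - b K) b); last exact: b0.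
- near=> K; rewrite -ler_norml normrM /b; apply: ler_pM => //.
    rewrite ger0_norm; last by rewrite invr_ge0 ltW ?expq_gt0.
    rewrite lef_pV2 ?posrE ?expq_gt0 //.
    by apply: ler_weXn2l; [exact: ltW | rewrite mulSn leq_addr].
  apply: le_trans (ler_norm_sum _ _ _) _.
  rewrite big_seq [leRHS]big_seq; apply: ler_sum => l.
  rewrite mem_partitions is_partition_ofE => /andP[Pl _].
  rewrite normrM (ger0_norm (wt_ge0 _ _)).
  case: (leqP (colLen l 1) K) => lK; last by rewrite /wt leqNgt lK /= mul0r.
  by rewrite ler_piMr ?wt_ge0 // V_bound //; lia.
- by rewrite -[X in _ --> X]oppr0; apply: cvgN; exact: b0.
Unshelve. all: by end_near. Qed.

(** Each induction step trades one unit of the counter for one box, keeping [j + r] fixed and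
    contributing a factor of [qpoch]. At [r = 0] the sum telescopes to the average of [g] with
    weights [wt K]. *)
Lemma cvg_partial r j : partial r j K @[K --> \oo] -->
  qpoch q r * \sum_(l <- partitions (j + r)) (den l)^-1 * g l.
Proof.
elim: r j => [|r IH] j.
  have -> : partial 0 j = fun K => \sum_(l <- partitions j) wt K l * g l.
    apply/funext => K; rewrite /partial; under eq_bigr do rewrite mul0n invr1 mul1r.
    have meang M N : mean 0 j M N = \sum_(l <- partitions j) wt M l * g l.
      by apply: eq_bigr => l _; rewrite V0.
    under eq_bigr do rewrite !meang.
    by rewrite (telescope_sumr (fun M => \sum_(l <- partitions j) wt M l * g l)) //
      meang invr1 mul1r subrK.
  rewrite /qpoch big_geq // mul1r addn0.
  by apply: cvg_sum => l _; apply: cvgM; [exact: cvg_wt | exact: cvg_cst].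
have -> : partial r.+1 j = fun K => (1 - q ^- r.+1) * partial r j.+1 K +
    q ^- (r.+1 * K.+1) * mean r.+1 j K K.+1.
  by apply/funext => K; exact: partial_rec.
rewrite qpochS addnS -addSn [qpoch q r * _]mulrC -mulrA -[X in _ --> X]addr0.
by apply: cvgD; [apply: cvgM; [exact: cvg_cst | exact: IH] | exact: cvg_mean_error].
Qed.

Lemma process_nil r :
  V r 1 [::] = q ^+ r * qpoch q r * \sum_(l <- partitions r) (den l)^-1 * g l.
Proof.
(* For size 0 only the empty partition occurs, with weight 1 for every [N]; the sequence is constant
   and equals its limit. *)
have e : partial r 0 = fun=> q ^- r * V r 1 [::].
  have mean1 M N : mean r 0 M N = V r N [::].
    by rewrite /mean partitions0 big_seq1 wt_nil mul1r.
  apply/funext => K; rewrite /partial mean1 big1 ?add0r // => N _.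
  by rewrite !mean1 subrr mulr0.
have := cvg_partial r 0; rewrite e add0n => /(cvg_lim (@Rhausdorff R)).
rewrite lim_cst // -mulrA => <-.
by rewrite mulrA mulfV ?expq_neq0 // mul1r.
Qed.
End Process.

(** * The procedure *)

Section GeometricMixture.
Variables (x : R) (F : nat -> R).
Hypotheses (x0 : 0 <= x) (x1 : x < 1).

(** Monotone convergence: the weights of the first [K] terms add up to [1 - x ^+ K]. Convergence is
    recorded because [limn] has its intended meaning only then. *)
Lemma geometric_mixture_bounds (a : nat) :
    (forall k, (a <= k)%N -> 0 <= F k <= 1) ->
  let u K := \sum_(k < K) (x ^+ k * (1 - x) * F (a + k)) in
  cvgn u /\ 0 <= limn u <= 1.
Proof.
move=> F01 u.
have uS K : u K.+1 = u K + x ^+ K * (1 - x) * F (a + K) by rewrite /u big_ord_recr.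
have term_ge0 K : 0 <= x ^+ K * (1 - x) * F (a + K).
  have /andP[F0 _] := F01 (a + K)%N (leq_addr _ _).
  by rewrite !mulr_ge0 ?exprn_ge0 // subr_ge0 ltW.
have nd : {homo u : m n / (m <= n)%N >-> m <= n}.
  by apply: homo_leq => [//|y z t|K]; [exact: le_trans | rewrite uS lerDl].
have u_ge0 K : 0 <= u K by rewrite /u sumr_ge0.
have u_le1 K : u K <= 1.
  apply: le_trans (_ : 1 - x ^+ K <= _); last by rewrite gerBl exprn_ge0.
  elim: K => [|K IH]; first by rewrite /u big_ord0 expr0 subrr.
  rewrite uS; apply: le_trans (lerD IH (_ : _ <= x ^+ K * (1 - x))) _.
    rewrite ler_piMr ?mulr_ge0 ?exprn_ge0 ?subr_ge0 ?(ltW x1) //.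
    by have /andP[] := F01 (a + K)%N (leq_addr _ _).
  by rewrite exprS; lra.
have cu : cvgn u.
  by apply: nondecreasing_is_cvgn => //; exists 1 => _ [K _ <-].
by split=> //; apply/andP; split; [apply: limr_ge | apply: limr_le] => //; near=> K.
Unshelve. all: by end_near. Qed.

(** Conditioning on the first toss: heads uses [F a], and tails restarts the same experiment at
    [a.+1]. *)
Lemma geometric_mixture_rec (a : nat) :
    (forall k, (a <= k)%N -> 0 <= F k <= 1) ->
  limn (fun K => \sum_(k < K) (x ^+ k * (1 - x) * F (a + k))) =
  (1 - x) * F a + x * limn (fun K => \sum_(k < K) (x ^+ k * (1 - x) * F (a.+1 + k))).
Proof.
move=> F01.
have [cv _] : _ /\ _ := geometric_mixture_bounds a.+1 (fun k ak => F01 k (ltnW ak)).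
apply: (cvg_lim (@Rhausdorff R)); rewrite -cvg_shiftS /=.
apply: (@eq_cvgn _ (fun K => (1 - x) * F a +
    x * \sum_(k < K) (x ^+ k * (1 - x) * F (a.+1 + k))) _ _) => // [K|].
  rewrite big_ord_recl expr0 mul1r addn0; congr (_ + _).
  by rewrite mulr_sumr; apply: eq_bigr => k _; rewrite /= addSnnS exprS; ring.
by apply: cvgD; [exact: cvg_cst | apply: cvgM; [exact: cvg_cst | exact: cv]].
Qed.
End GeometricMixture.

(** [f] is bounded only where [p] is nonzero: a box put into a column of probability 0 may spoil the
    invariants on which the bound for [run] rests. *)
Lemma weighted_sum_bounds (p f : nat -> R) (r : seq nat) :
  (forall s, s \in r -> 0 <= p s) -> \sum_(s <- r) p s = 1 ->
  (forall s, s \in r -> p s != 0 -> 0 <= f s <= 1) -> 0 <= \sum_(s <- r) p s * f s <= 1.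
Proof.
move=> p0 p1 f01.
have pf s : s \in r -> 0 <= p s * f s <= p s.
  move=> sr; have [->|ps] := eqVneq (p s) 0; first by rewrite mul0r lexx.
  have /andP[f0 f1] := f01 s sr ps.
  by rewrite mulr_ge0 ?p0 //= ler_piMr ?p0.
rewrite big_seq sumr_ge0 => [|s /pf /andP[] //].
by rewrite -p1 [leRHS]big_seq ler_sum // => s /pf /andP[].
Qed.

Lemma expVq_bounds r : 0 <= q ^- r.+1 /\ q ^- r.+1 < 1.
Proof.
by split; [rewrite invr_ge0 ltW ?expq_gt0 | rewrite -subr_gt0 subr_expVq_gt0].
Qed.

Section Run.
Variable mu : seq nat.

Let step r l N := \sum_(1 <= s < (ncols l).+2) p2 q N l s * run q r N (addBox l s) mu.

Lemma runS r N l : run q r.+1 N l mu = limn (fun K => \sum_(k < K)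
  (q ^- r.+1 ^+ k * (1 - q ^- r.+1) * step r l (N + k))).
Proof. by rewrite /= subKr. Qed.

Lemma step_bounds r N l :
    (forall l', is_part l' -> (colLen l' 1 <= N)%N -> 0 <= run q r N l' mu <= 1) ->
  is_part l -> (0 < N)%N -> (colLen l 1 <= N)%N -> 0 <= step r l N <= 1.
Proof.
move=> IH Pl N0 lN; have /andP[Sl _] := Pl.
apply: weighted_sum_bounds => [s _||s]; [exact: p2_ge0 | exact: sum_p2|].
rewrite mem_index_iota => /andP[s0 _] ps.
have al : addable l s by apply: contraNT ps => al; rewrite p2_not_addable.
apply: IH; first exact: is_part_addBox.
rewrite colLen_addBox //; case: eqP => [s1|_]; last by rewrite addn0.
(* A first column already of length [N] has probability 0 of being chosen, so the bound by [N]
   persists. *)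
rewrite addn1 ltn_neqAle lN andbT; apply: contraNneq ps => e.
by rewrite -s1 /p2 /= e mulfV ?expq_neq0 // subrr mul0r.
Qed.

Lemma run_bounds r N l : is_part l -> (0 < N)%N -> (colLen l 1 <= N)%N ->
  0 <= run q r N l mu <= 1.
Proof.
elim: r N l => [|r IH] N l Pl N0 lN.
  have /andP[Sl _] := Pl.
  apply: weighted_sum_bounds => [s _||s _ _]; [exact: p3_ge0 | exact: sum_p3 |].
  by case: (_ == _); rewrite ?lexx ler01.
rewrite runS; have [x0 x1] := expVq_bounds r.
apply: (geometric_mixture_bounds _ _ x0 x1 N _).2 => k Nk.
by apply: step_bounds => // [l' Pl' l'k||]; [apply: IH => //|..]; lia.
Qed.

Lemma run_rec r N l : is_part l -> (0 < N)%N -> (colLen l 1 <= N)%N ->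
  run q r.+1 N l mu =
    (1 - q ^- r.+1) *
      (\sum_(1 <= s < (ncols l).+2) p2 q N l s * run q r N (addBox l s) mu) +
    q ^- r.+1 * run q r.+1 N.+1 l mu.
Proof.
move=> Pl N0 lN; rewrite !runS; have [x0 x1] := expVq_bounds r.
rewrite (geometric_mixture_rec _ (step r l) x0 x1) // => k Nk.
by apply: step_bounds => // [l' Pl' l'k||]; [apply: run_bounds => //|..]; lia.
Qed.

Lemma run_nil n : run q n 1 [::] mu = q ^+ n * qpoch q n *
  \sum_(l <- partitions n.+1) (q ^+ colLen l 1 - 1) / den l * (l == mu)%:R.
Proof.
rewrite -sum_p3_addBox (process_nil (fun r N l => run q r N l mu)
  (fun l => \sum_(1 <= s < (ncols l).+2) p3 q l s * (addBox l s == mu)%:R)) //.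
- move=> r N l Pl N0 lN; have /andP[r0 r1] := run_bounds r N l Pl N0 lN.
  by rewrite ger0_norm.
- exact: run_rec.
Qed.

End Run.

(** * Normalisation and the conditioned measure *)

Lemma sum_weights n : 1 = q ^+ n * qpoch q n *
  \sum_(l <- partitions n.+1) (q ^+ colLen l 1 - 1) / den l.
Proof.
have -> : \sum_(l <- partitions n.+1) (q ^+ colLen l 1 - 1) / den l =
    \sum_(l <- partitions n) (den l)^-1 * 1.
  under eq_bigr do rewrite -[_ / _]mulr1.
  rewrite -(sum_p3_addBox n (fun=> 1)); apply: eq_big_seq => l.
  rewrite mem_partitions => /and3P[Sl _ _].
  by under eq_bigr do rewrite mulr1; rewrite sum_p3.
(* The constant 1 satisfies the recursion because the [p2] sum to 1 and the coin probabilities add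
   up to 1. *)
apply: (process_nil (fun _ _ _ => 1) (fun=> 1)) => //.
- by move=> *; rewrite normr1.
- move=> r N l /andP[Sl _] N0 _; under eq_bigr do rewrite mulr1.
  by rewrite sum_p2 // !mulr1 subrK.
Qed.

(** Conditioning divides by this product, so it must be nonzero; the partial products decrease and
    stay above a fixed exponential. *)
Lemma infprod_gt0 u : 0 < u -> u < 1 -> 0 < infprod u q.
Proof.
move=> u0 u1; pose P K := \prod_(1 <= r < K.+1) (1 - u / q ^+ r).
have PS K : P K.+1 = P K * (1 - u / q ^+ K.+1) by rewrite /P big_nat_recr.
have f_le1 r : 1 - u / q ^+ r <= 1 by rewrite gerBl divr_ge0 ?ltW ?expq_gt0.
have u_lt r : u / q ^+ r <= u.
  rewrite ler_pdivrMr ?expq_gt0 // ler_peMr ?(ltW u0) // exprn_ege1 // ltW //.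
have f_gt0 r : 0 < 1 - u / q ^+ r by rewrite subr_gt0 (le_lt_trans (u_lt r)).
have P_gt0 K : 0 < P K by apply: prodr_gt0.
(* The sum over [r >= 1] of the geometric series [u / (1 - u) / q ^+ r]. *)
pose c := u / (1 - u) / (q - 1).
have c0 : 0 <= c by rewrite !divr_ge0 ?subr_ge0 ?ltW.
(* [1 / (1 - y) <= 1 + y / (1 - u) <= exp (y / (1 - u))] for [0 <= y <= u]; the
   exponents form a geometric series. *)
have P_ge K : expR (- c * (1 - q ^- K)) <= P K.
  elim: K => [|K IH]; first by rewrite expr0 invr1 subrr mulr0 expR0 /P big_geq.
  rewrite PS.
  have -> : - c * (1 - q ^- K.+1) = - c * (1 - q ^- K) - u / (1 - u) / q ^+ K.+1.
    rewrite /c exprS; field.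
    by rewrite expq_neq0 (gt_eqF q_gt0) !gt_eqF // subr_gt0.
  rewrite expRD ler_pM ?expR_ge0 // expRN -[leRHS]invrK.
  rewrite lef_pV2 ?posrE ?expR_gt0 ?invr_gt0 //.
  apply: le_trans (expR_ge1Dx _).
  rewrite -[leLHS]mul1r ler_pdivrMr //.
  have qK0 := expq_gt0 K.+1; have qK1 := exprn_ege1 K.+1 (ltW q1).
  set y := u / q ^+ K.+1; have yu : y <= u := u_lt K.+1.
  have -> : u / (1 - u) / q ^+ K.+1 = y / (1 - u).
    by rewrite /y mulrAC.
  have y0 : 0 <= y by rewrite divr_ge0 // ltW.
  have u1' : 0 < 1 - u by rewrite subr_gt0.
  have -> : (1 + y / (1 - u)) * (1 - y) = 1 + y / (1 - u) * (u - y).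
    by field; rewrite gt_eqF.
  by rewrite lerDl mulr_ge0 ?divr_ge0 ?subr_ge0 // ltW.
have P_lb K : expR (- c) <= P K.
  apply: le_trans (P_ge K); rewrite ler_expR mulNr lerN2 ler_piMr // gerBl.
  by rewrite invr_ge0 ltW ?expq_gt0.
have cP : cvgn P.
  apply: nonincreasing_is_cvgn; last by exists (expR (- c)) => _ [K _ <-].
  apply/nonincreasing_seqP => K; rewrite PS ler_piMr //; exact: ltW.
apply: lt_le_trans (expR_gt0 (- c)) _; rewrite /infprod -/P.
by apply: limr_ge; [exact: cP | near=> K; exact: P_lb].
Unshelve. all: by end_near. Qed.
End Weights.

Theorem theorem3p8 (R : realType) (q u : R) (n : nat) :
  1 < q -> 0 < u -> u < 1 ->
  forall mu : seq nat, output_prob q n mu = Nuq_cond u q n.+1 mu.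
Proof.
move=> q1 u0 u1 mu; rewrite /output_prob run_nil // /Nuq_cond.
have ip := infprod_gt0 _ _ q1 _ u0 u1.
case: ifPn => Pmu; last first.
  rewrite big1_seq ?mulr0 // => l /andP[_]; rewrite mem_partitions => Pl.
  by rewrite (_ : (l == mu) = false) ?mulr0 //; apply: contraNF Pmu => /eqP <-.
rewrite (bigD1_seq mu) ?mem_partitions ?partitions_uniq //= eqxx mulr1.
rewrite big1 ?addr0; last by move=> l /negbTE ->; rewrite mulr0.
(* On partitions of [n.+1] the infinite product and the power of [u] are common factors, which
   cancel in the conditional probability. *)
have NuqE l : is_partition_of n.+1 l ->
    Nuq u q l = infprod u q * u ^+ n * ((q ^+ colLen l 1 - 1) / den R q l).
  by move=> /and3P[_ _ /eqP sl]; rewrite /Nuq sl /= -/(den R q l) !mulrA.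
have -> : \sum_(nu <- partitions n.+1) Nuq u q nu =
    infprod u q * u ^+ n * (q ^+ n * qpoch q n)^-1.
  rewrite (_ : \sum_(_ <- _) _ = infprod u q * u ^+ n *
    \sum_(l <- partitions n.+1) (q ^+ colLen l 1 - 1) / den R q l).
    congr (_ * _); apply: (@mulfI _ (q ^+ n * qpoch q n)).
      by rewrite mulf_neq0 ?expq_neq0 ?qpoch_neq0.
    by rewrite -sum_weights // mulfV // mulf_neq0 ?expq_neq0 ?qpoch_neq0.
  by rewrite mulr_sumr; apply: eq_big_seq => l; rewrite mem_partitions => /NuqE.
rewrite NuqE // invfM invrK.
have c0 : infprod u q * u ^+ n != 0 by rewrite mulf_neq0 ?expf_neq0 // gt_eqF.
rewrite [_ * (_^-1 * _)]mulrA [infprod u q * _ * _ / _]mulrAC mulfV // mul1r.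
by rewrite mulrC.
Qed.
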